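(* Let $K$ be a field with $\operatorname{char} K\neq 2$, let $a\in K^\times\setminus K^{\times 2}$, let $n\geq 2$, and let $S_n$ act on $K(x_1,\ldots,x_n)$ by the twisted action defined in the context. Let $v_1,\ldots,v_{n-1}$ and $h(v_1,\ldots,v_{n-1})$ be as defined in the context. Then there exist elements $x,y$ such that $$K(x_1,\ldots,x_n)^{S_n}=K(x,y,v_1,\ldots,v_{n-1}),$$ and the generators $x,y,v_1,\ldots,v_{n-1}$ satisfy the relation $$x^2-ay^2=h(v_1,\ldots,v_{n-1}).$$
   Context: Twisted action: $S_n$ acts on the rational function field $K(x_1,\ldots,x_n)$ by $K$-automorphisms with $\sigma(x_i)=x_{\sigma(i)}$ if $\sigma\in A_n$ and $\sigma(x_i)=a/x_{\sigma(i)}$ if $\sigma\in S_n\setminus A_n$. Let $\alpha=\sqrt a$ and $\mathrm{Gal}(K(\alpha)/K)=\langle\rho\rangle$, $\rho(\alpha)=-\alpha$. Extend the actions of $S_n$ and $\rho$ to $K(\alpha)(x_1,\ldots,x_n)=K(\alpha)\otimes_K K(x_1,\ldots,x_n)$ so that $S_n$ acts trivially on $K(\alpha)$ and $\rho$ acts trivially on $K(x_1,\ldots,x_n)$. Define $z_i=(\alpha-x_i)/(\alpha+x_i)$ for $1\le i\le n$, $z_0=z_1+\cdots+z_n$, and $y_i=z_i/z_0$ for $1\le i\le n$ (so $y_1+\cdots+y_n=1$). Let $t_1,\ldots,t_n$ be the elementary symmetric functions of $y_1,\ldots,y_n$ (so $t_1=1$), and put $t_0=1$. Let $\Delta=\prod_{1\le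 i<j\le n}(y_i-y_j)$; $\Delta^2$ is a polynomial in $t_2,\ldots,t_n$. Define $$f(t_2,\ldots,t_n)=(-1)^{n(n-1)/2}\,t_n^{-(n-1)}\,(t_n/t_{n-1})^{(n+1)(n-2)/2}\,\Delta^2 .$$ Write $n=2m+1$ if $n$ is odd and $n=2m$ if $n$ is even. Define $$u_i=t_{i+1},\qquad u_{n-i}=\rho(t_{i+1})=t_{n-(i+1)}\,t_n^{i}/t_{n-1}^{i+1}\qquad (1\le i\le m-1),$$ and, if $n$ is odd, $u_m=t_{m+1}$, $u_{m+1}=\rho(t_{m+1})=t_m t_n^m/t_{n-1}^{m+1}$; if $n$ is even, $u_m=t_n/t_{n-1}$. If $n=2m+1$ is odd, define $v_i=(u_i+u_{n-i})/2$ and $v_{n-i}=\alpha(u_i-u_{n-i})/2$ for $1\le i\le m$. If $n=2m$ is even, define $v_m=u_m$, and $v_i=(u_i+u_{n-i})/2$, $v_{n-i}=\alpha(u_i-u_{n-i})/2$ for $1\le i\le m-1$. Finally $h(v_1,\ldots,v_{n-1})$ denotes $f(t_2,\ldots,t_n)$ expressed as a rational function of $v_1,\ldots,v_{n-1}$. *)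

(* Defs.v *)
From HB Require Import structures.
From mathcomp Require Import all_boot all_order all_fingroup all_algebra all_field.
From mathcomp Require Import generic_quotient.
From mathcomp.multinomials Require Import mpoly.

Set Implicit Arguments.
Unset Strict Implicit.
Unset Printing Implicit Defensive.

Import GRing.Theory.
Local Open Scope ring_scope.

Local Notation "x %:F" := (@FracField.tofrac _ x).

(* The rational function field K(x_0, ..., x_{n-1}); the variable written x_i
   in the usual 1-based numbering is [rfX K j] with j : 'I_n of value i - 1. *)
Notation ratfun K n := {fraction {mpoly K[n]}}.

Definition rfC (K : fieldType) (n : nat) (c : K) : ratfun K n := (c%:MP)%:F.
Definition rfX (K : fieldType) (n : nat) (j : 'I_n) : ratfun K n := ('X_j)%:F.

Lemma frac_repr (R : idomainType) (q : {fraction R}) :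
  q * (\d_(repr q))%:F = (\n_(repr q))%:F.
Proof.
rewrite -[q in LHS]reprK /FracField.tofrac; unlock.
rewrite -[LHS]FracField.pi_mul; apply/eqmodP => /=.
rewrite FracField.equivfE /FracField.mulf !numden_Ratio ?mulf_neq0 ?oner_neq0 ?denom_ratioP //.
by rewrite !mulr1 reprK mulrC.
Qed.

Section Substitution.

Variables (K F : fieldType) (n : nat) (emb : K -> F) (w : 'I_n -> F).

(* Substitution of w for the variables, through the canonical representative
   of q.  It is only used below (for the twisted action, rho, and the inclusion
   of K(x) in L(x)) with an emb that is a ring morphism and a w that is
   algebraically independent over the image of emb; it is then the unique
   field morphism extending emb and sending x_j to w j (see [rf_substE]). *)
Definition rf_subst (q : ratfun K n) : F :=
  mmap emb w \n_(repr q) / mmap emb w \d_(repr q).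

(* The rational function q is defined at the point w, with value z there.
   No assumption on w is made. *)
Definition rf_value (q : ratfun K n) (z : F) : Prop :=
  exists num den : {mpoly K[n]},
    [/\ q = num%:F / den%:F, mmap emb w den != 0 &
        z = mmap emb w num / mmap emb w den].

End Substitution.

Lemma rf_substE (K F : fieldType) (n : nat) (emb : {rmorphism K -> F})
    (w : 'I_n -> F) (indep : forall p, mmap emb w p = 0 -> p = 0)
    (num den : {mpoly K[n]}) :
  den != 0 ->
  rf_subst emb w (num%:F / den%:F) = mmap emb w num / mmap emb w den.
Proof.
move=> den0; rewrite /rf_subst; set q := num%:F / den%:F.
have nz p : p != 0 -> mmap emb w p != 0.
  by move=> p0; apply: contra_neq p0; apply: indep.
have mM p1 p2 : mmap emb w (p1 * p2) = mmap emb w p1 * mmap emb w p2.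
  exact: (rmorphM (mmap emb w)).
have e : num * \d_(repr q) = \n_(repr q) * den.
  apply/eqP; rewrite -tofrac_eq !tofracM -(frac_repr q) mulrAC.
  by rewrite mulfVK ?tofrac_eq0.
by apply/eqP; rewrite eqr_div ?nz ?denom_ratioP // -!mM e.
Qed.

(* K(G): the smallest subfield of F containing the image of K and G. *)
Inductive adjoin (K F : fieldType) (emb : K -> F) (G : seq F) : F -> Prop :=
| adjoin_const c : adjoin emb G (emb c)
| adjoin_gen g : g \in G -> adjoin emb G g
| adjoin_sub z1 z2 :
    adjoin emb G z1 -> adjoin emb G z2 -> adjoin emb G (z1 - z2)
| adjoin_div z1 z2 :
    adjoin emb G z1 -> adjoin emb G z2 -> adjoin emb G (z1 / z2).

Section TwistedAction.

Variables (K : fieldType) (a : K) (n : nat).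

(* [odd_perm s] means that s is not in A_n. *)
Definition twisted_var (s : 'S_n) (j : 'I_n) : ratfun K n :=
  if odd_perm s then rfC n a / rfX K (s j) else rfX K (s j).

Definition twisted_act (s : 'S_n) : ratfun K n -> ratfun K n :=
  rf_subst (@rfC K n) (twisted_var s).

Definition twisted_fixed (q : ratfun K n) : Prop :=
  forall s : 'S_n, twisted_act s q = q.

End TwistedAction.

Section Generators.

(* L is meant to be K(alpha), and rhoL the generator of Gal(L / K). *)
Variables (K : fieldType) (L : fieldExtType K) (alpha : L) (rhoL : L -> L).
Variable n : nat.

Definition baseC (c : K) : ratfun L n := rfC n (c%:A : L).

Definition incl : ratfun K n -> ratfun L n := rf_subst baseC (@rfX L n).

Definition rho : ratfun L n -> ratfun L n :=
  rf_subst (fun c => rfC n (rhoL c)) (@rfX L n).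

Definition zvar (j : 'I_n) : ratfun L n :=
  (rfC n alpha - rfX L j) / (rfC n alpha + rfX L j).

Definition z0 : ratfun L n := \sum_(j < n) zvar j.

Definition yvar (j : 'I_n) : ratfun L n := zvar j / z0.

Definition t (k : nat) : ratfun L n := (mesym n (ratfun L n) k).@[yvar].

Definition Delta : ratfun L n :=
  \prod_(i < n) \prod_(j < n | (i < j)%N) (yvar i - yvar j).

Definition f_of_t : ratfun L n :=
  (-1) ^+ (n * n.-1)./2 * (t n) ^- n.-1
    * (t n / t n.-1) ^+ (n.+1 * (n - 2))./2 * Delta ^+ 2.

(* u k and v k are meaningful for 1 <= k <= n - 1.  With m = n./2, the index
   k > m is written n - i with i = n - k. *)
Definition u (k : nat) : ratfun L n :=
  if ~~ odd n && (k == n./2) then t n / t n.-1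
  else if (k <= n./2)%N then t k.+1
  else rho (t (n - k).+1).

Definition v (k : nat) : ratfun L n :=
  if ~~ odd n && (k == n./2) then u k
  else if (k <= n./2)%N then (u k + u (n - k)) / 2
  else rfC n alpha * (u (n - k) - u k) / 2.

End Generators.

(* Main.v *)
Require Import Defs.
From HB Require Import structures.
From mathcomp Require Import all_boot all_order all_fingroup all_algebra all_field.
From mathcomp Require Import generic_quotient zify ring.
From mathcomp.multinomials Require Import mpoly.

Set Implicit Arguments.
Unset Strict Implicit.
Unset Printing Implicit Defensive.

Import GRing.Theory.
Local Open Scope ring_scope.

Local Notation "x %:F" := (@FracField.tofrac _ x).

(* Over L = K(alpha) the coordinates z_j turn the twisted action into signed
   permutations, s(z_j) = sgn(s) z_(s j), and rho into inversion,
   rho(z_j) = 1 / z_j.  An S_n-invariant is a quotient of invariant polynomials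
   in the z_j.  Their homogeneous parts of even degree are symmetric, those of
   odd degree become symmetric after multiplication by Delta, so
   L(x)^(S_n) = L(t_2, ..., t_n, Z) with Z = z_0 Delta.  From
   rho(t_k) = w^k t_(n-k) / t_n with w = t_n / t_(n-1) one recovers every t_k
   from the u_i, so L(t_2, ..., t_n) = L(v_1, ..., v_(n-1)), and each v_i is
   fixed by rho.  Since Z rho(Z) = f, the elements x = (Z + rho(Z)) / 2 and
   y = (Z - rho(Z)) / (2 alpha) satisfy x^2 - a y^2 = f, and taking rho-invariants
   of L(x, y, v_1, ..., v_(n-1)) leaves K(x, y, v_1, ..., v_(n-1)). *)

(** * Ring morphisms on polynomial rings *)

Lemma mpoly_ring_ind (n : nat) (R : comNzRingType) (P : {mpoly R[n]} -> Prop) :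
  (forall c, P c%:MP) -> (forall i, P 'X_i) ->
  (forall p q, P p -> P q -> P (p + q)) ->
  (forall p q, P p -> P q -> P (p * q)) -> forall p, P p.
Proof.
move=> PC PX PD PM; elim/mpolyind=> [|c m p _ _ Pp]; first by rewrite -mpolyC0.
apply: (PD) => //; rewrite -mul_mpolyC; apply: (PM) => //.
rewrite mpolyXE_id; apply: (big_ind P) => [|//|i _]; first by rewrite -mpolyC1.
elim: (m i) => [|k IHk]; first by rewrite expr0 -mpolyC1.
by rewrite exprS; apply: (PM).
Qed.

Lemma mmap_rmorph (n : nat) (R S S' : comNzRingType) (phi : {rmorphism S -> S'})
    (emb : {rmorphism R -> S}) (w : 'I_n -> S) (p : {mpoly R[n]}) :
  phi (mmap emb w p) = mmap (phi \o emb) (phi \o w) p.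
Proof.
elim/mpoly_ring_ind: p => [c|i|p q IHp IHq|p q IHp IHq].
- by rewrite !mmapC.
- by rewrite !mmapX !mmap1U.
- by rewrite !mmapD rmorphD IHp IHq.
- by rewrite !rmorphM /= IHp IHq.
Qed.

Lemma eq_mmap (n : nat) (R S : nzRingType) (f g : R -> S) (w w' : 'I_n -> S) :
  f =1 g -> w =1 w' -> mmap f w =1 mmap g w'.
Proof.
move=> efg eww p; rewrite /mmap; apply: eq_bigr => m _.
by rewrite efg (mmap1_eq _ eww).
Qed.

(** * Substitution in rational functions *)

HB.instance Definition _ (K : fieldType) (n : nat) :=
  GRing.RMorphism.copy (@rfC K n) (@FracField.tofrac _ \o @mpolyC n K).
HB.instance Definition _ (K : fieldType) (L : fieldExtType K) (n : nat) :=
  GRing.RMorphism.copy (@baseC K L n) (@rfC L n \o in_alg L).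

Lemma mmap_rfX (K : fieldType) (n : nat) (p : {mpoly K[n]}) :
  mmap (@rfC K n) (@rfX K n) p = p%:F.
Proof.
elim/mpoly_ring_ind: p => [c|i|p q IHp IHq|p q IHp IHq].
- by rewrite mmapC.
- by rewrite mmapX mmap1U.
- by rewrite mmapD rmorphD /= IHp IHq.
- by rewrite !rmorphM /= IHp IHq.
Qed.

Lemma ratfun_div (K : fieldType) (n : nat) (q : ratfun K n) :
  exists num den : {mpoly K[n]}, den != 0 /\ q = num%:F / den%:F.
Proof.
exists (\n_(repr q)), (\d_(repr q)); split; first exact: denom_ratioP.
by rewrite -frac_repr mulfK // tofrac_eq0 denom_ratioP.
Qed.

(** The constants and variables generate the field. The commutation rules among [rho], the inclusion
    and the twisted action are all checked on these generators through this lemma. *)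
Lemma ratfun_rmorph_eq (K F : fieldType) (n : nat)
    (phi psi : {rmorphism ratfun K n -> F}) :
  (forall c, phi (rfC n c) = psi (rfC n c)) ->
  (forall j, phi (rfX K j) = psi (rfX K j)) -> phi =1 psi.
Proof.
move=> eC eX q; have [num [den [den0 ->]]] := ratfun_div q.
rewrite !fmorph_div -!mmap_rfX !mmap_rmorph.
by congr (_ / _); apply: eq_mmap.
Qed.

Definition alg_indep (K F : fieldType) (n : nat) (emb : K -> F) (w : 'I_n -> F) :=
  forall p, mmap emb w p = 0 -> p = 0.

(** Independence keeps every nonzero denominator nonzero at [w], so the value does not depend on the
    chosen fraction and sums and products can be computed on any representatives. The result is a
    [sig], so that a family of morphisms indexed by permutations can be extracted with [sval]. *)
Lemma rf_subst_rmorph (K F : fieldType) (n : nat) (emb : {rmorphism K -> F})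
    (w : 'I_n -> F) (indep : alg_indep emb w) :
  {phi : {rmorphism ratfun K n -> F} |
    [/\ rf_subst emb w =1 phi, forall c, phi (rfC n c) = emb c
      & forall j, phi (rfX K j) = w j]}.
Proof.
have E := rf_substE indep.
have nz p : p != 0 -> mmap emb w p != 0.
  by move=> p0; apply: contra_neq p0; apply: indep.
have E1 p : rf_subst emb w p%:F = mmap emb w p.
  by rewrite -[p%:F]divr1 -tofrac1 E ?oner_neq0 // rmorph1 divr1.
have zm : zmod_morphism (rf_subst emb w).
  move=> q1 q2; have [n1 [d1 [d10 ->]]] := ratfun_div q1.
  have [n2 [d2 [d20 ->]]] := ratfun_div q2.
  have -> : n1%:F / d1%:F - n2%:F / d2%:F = (n1 * d2 - n2 * d1)%:F / (d1 * d2)%:F.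
    by rewrite tofracB !tofracM -[in RHS]mulNr -addf_div ?tofrac_eq0 // mulNr.
  rewrite !E ?mulf_neq0 // rmorphB !rmorphM /= -mulNr -addf_div ?nz //.
  by rewrite mulNr.
have mm : monoid_morphism (rf_subst emb w).
  split=> [|q1 q2]; first by rewrite -tofrac1 E1 rmorph1.
  have [n1 [d1 [d10 ->]]] := ratfun_div q1.
  have [n2 [d2 [d20 ->]]] := ratfun_div q2.
  have -> : n1%:F / d1%:F * (n2%:F / d2%:F) = (n1 * n2)%:F / (d1 * d2)%:F.
    by rewrite !tofracM mulf_div.
  by rewrite !E ?mulf_neq0 // !rmorphM /= mulf_div.
pose A := GRing.isZmodMorphism.Build _ _ _ zm.
pose B := GRing.isMonoidMorphism.Build _ _ _ mm.
pose phi : {rmorphism ratfun K n -> F} := HB.pack (rf_subst emb w) A B.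
exists phi; split=> // [c|j]; rewrite /phi /=; first by rewrite /rfC E1 mmapC.
by rewrite /rfX E1 mmapX mmap1U.
Qed.

(** Evaluation at the variables is coefficientwise application of [g], which is injective. Taking
    [g] to be [in_alg L] serves [incl], and [rhoL] serves [rho]. *)
Lemma rfX_indep (K F : fieldType) (n : nat) (g : {rmorphism K -> F}) :
  alg_indep (fun c => rfC n (g c)) (@rfX F n).
Proof.
move=> p.
have -> : mmap (fun c => rfC n (g c)) (@rfX F n) p = (map_mpoly g p)%:F.
  elim/mpoly_ring_ind: p => [c|i|p q IHp IHq|p q IHp IHq].
  - by rewrite (mmapC _ (@rfC F n \o g)) map_mpolyC.
  - by rewrite (mmapX _ (@rfC F n \o g)) mmap1U map_mpolyX.
  - by rewrite (mmapD _ (@rfC F n \o g)) !rmorphD /= IHp IHq.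
  - by rewrite (rmorphM (mmap (@rfC F n \o g) _)) !rmorphM /= IHp IHq.
move/eqP; rewrite tofrac_eq0 => /eqP gp0; apply/mpolyP => m; rewrite mcoeff0.
by apply: (fmorph_inj g); rewrite -mcoeff_map_mpoly gp0 mcoeff0 rmorph0.
Qed.

(** The polynomial [q] and the exponent [N] depend only on [p], [num] and [den], not on the point
    [x]: one identity can thus be read at two different points. *)
Lemma mmap_clear_denominators (K : fieldType) (n : nat)
    (num den : 'I_n -> {mpoly K[n]}) (p : {mpoly K[n]}) :
  exists (q : {mpoly K[n]}) (N : nat),
    forall x : 'I_n -> ratfun K n, (forall j, mmap (@rfC K n) x (den j) != 0) ->
      mmap (@rfC K n) x q = mmap (@rfC K n) x (\prod_j den j) ^+ N *
        mmap (@rfC K n)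
          (fun j => mmap (@rfC K n) x (num j) / mmap (@rfC K n) x (den j)) p.
Proof.
elim/mpoly_ring_ind: p => [c|i|p1 p2 [q1 [N1 H1]] [q2 [N2 H2]]
                          |p1 p2 [q1 [N1 H1]] [q2 [N2 H2]]].
- by exists c%:MP, 0 => x _; rewrite !mmapC mul1r.
- exists (num i * \prod_(j | j != i) den j), 1 => x nz.
  rewrite mmapX mmap1U expr1 [X in _ = mmap _ _ X * _](bigD1 i) //= !rmorphM /=.
  by rewrite [RHS]mulrAC [_ * (_ / _)]mulrC mulfVK.
- exists (q1 * (\prod_j den j) ^+ N2 + q2 * (\prod_j den j) ^+ N1), (N1 + N2)%N.
  move=> x nz; rewrite !rmorphD !rmorphM /= !rmorphXn /= H1 // H2 // exprD.
  by rewrite mulrDr; congr (_ + _); rewrite mulrAC // [X in X * _]mulrC.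
- exists (q1 * q2), (N1 + N2)%N => x nz.
  by rewrite !rmorphM /= H1 // H2 // exprD mulrACA.
Qed.

(* If p(w) = 0, clearing denominators gives a polynomial identity in the
   variables, which may then be evaluated at w'; there it reads p(X) = 0. *)
Lemma invertible_subst_indep (K : fieldType) (n : nat)
    (num den : 'I_n -> {mpoly K[n]}) (w w' : 'I_n -> ratfun K n) :
  (forall j, den j != 0) -> (forall j, w j = (num j)%:F / (den j)%:F) ->
  (forall j, mmap (@rfC K n) w' (den j) != 0) ->
  (forall j, mmap (@rfC K n) w' (num j) / mmap (@rfC K n) w' (den j) = rfX K j) ->
  alg_indep (@rfC K n) w.
Proof.
move=> den0 wE den'0 w'E p pw0.
have [q [N qE]] := mmap_clear_denominators num den p.
have q0 : q = 0.
  apply/eqP; rewrite -tofrac_eq0 -mmap_rfX qE => [|j]; last first.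
    by rewrite mmap_rfX tofrac_eq0.
  set p' := mmap _ _ p; suff -> : p' = mmap (@rfC K n) w p by rewrite pw0 mulr0.
  by apply: eq_mmap => // j; rewrite !mmap_rfX wE.
apply/eqP; rewrite -tofrac_eq0 -mmap_rfX.
have /eqP := qE w' den'0; rewrite q0 raddf0 eq_sym mulf_eq0.
case/orP=> [|/eqP e]; last first.
  by apply/eqP; rewrite -[RHS]e; apply: eq_mmap => // j; rewrite w'E.
rewrite expf_eq0 rmorph_prod => /andP[_ /prodf_eq0[j _]].
by rewrite (negbTE (den'0 j)).
Qed.

(** * Generated subfields *)

Section Adjoin.

Variables (K F : fieldType) (emb : {rmorphism K -> F}) (G : seq F).
Local Notation KG := (adjoin emb G).

Lemma adjoin0 : KG 0.
Proof. by rewrite -(rmorph0 emb); apply: adjoin_const. Qed.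

Lemma adjoin1 : KG 1.
Proof. by rewrite -(rmorph1 emb); apply: adjoin_const. Qed.

Lemma adjoinN z : KG z -> KG (- z).
Proof. by move=> Gz; rewrite -sub0r; apply: adjoin_sub => //; apply: adjoin0. Qed.

Lemma adjoinD z1 z2 : KG z1 -> KG z2 -> KG (z1 + z2).
Proof. by move=> G1 G2; rewrite -[z2]opprK; apply: adjoin_sub => //; apply: adjoinN. Qed.

Lemma adjoinV z : KG z -> KG z^-1.
Proof. by move=> Gz; rewrite -div1r; apply: adjoin_div => //; apply: adjoin1. Qed.

Lemma adjoinM z1 z2 : KG z1 -> KG z2 -> KG (z1 * z2).
Proof. by move=> G1 G2; rewrite -[z2]invrK; apply: adjoin_div => //; apply: adjoinV. Qed.

Lemma adjoinX z k : KG z -> KG (z ^+ k).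
Proof.
move=> Gz; elim: k => [|k IHk]; first by rewrite expr0; apply: adjoin1.
by rewrite exprS; apply: adjoinM.
Qed.

Lemma adjoin_sum (I : Type) (r : seq I) (P : pred I) (f : I -> F) :
  (forall i, P i -> KG (f i)) -> KG (\sum_(i <- r | P i) f i).
Proof. by move=> Gf; apply: (big_ind KG) => //; [apply: adjoin0 | apply: adjoinD]. Qed.

Lemma adjoin_mmap (k : nat) (w : 'I_k -> F) (p : {mpoly K[k]}) :
  (forall j, KG (w j)) -> KG (mmap emb w p).
Proof.
move=> Gw; elim/mpoly_ring_ind: p => [c|i|p q IHp IHq|p q IHp IHq].
- by rewrite mmapC; apply: adjoin_const.
- by rewrite mmapX mmap1U.
- by rewrite mmapD; apply: adjoinD.
- by rewrite rmorphM; apply: adjoinM.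
Qed.

Lemma adjoin_sub_adjoin (K' : fieldType) (emb' : K' -> F) (G' : seq F) z :
  (forall c, KG (emb' c)) -> {in G', forall g, KG g} -> adjoin emb' G' z -> KG z.
Proof.
move=> Kc KG'; elim=> {z} [c|g|z1 z2 _ G1 _ G2|z1 z2 _ G1 _ G2] //; first exact: KG'.
  exact: adjoin_sub.
exact: adjoin_div.
Qed.

Lemma adjoin_fixed (phi : {rmorphism F -> F}) z :
  (forall c, phi (emb c) = emb c) -> {in G, forall g, phi g = g} -> KG z -> phi z = z.
Proof.
move=> phiK phiG; elim=> {z} [c|g|z1 z2 _ e1 _ e2|z1 z2 _ e1 _ e2] //.
- exact: phiG.
- by rewrite rmorphB e1 e2.
- by rewrite fmorph_div e1 e2.
Qed.

Lemma adjoin_ratio (k : nat) (w : 'I_k -> F) z :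
  {in G, forall g, exists j, g = w j} -> KG z ->
  exists num den : {mpoly K[k]},
    mmap emb w den != 0 /\ z = mmap emb w num / mmap emb w den.
Proof.
move=> Gw; elim=> {z} [c|g /Gw[j ->]|z1 z2 _ [n1 [d1 [d10 ->]]] _ [n2 [d2 [d20 ->]]]|
                      z1 z2 _ [n1 [d1 [d10 ->]]] _ [n2 [d2 [d20 ->]]]].
- by exists c%:MP, 1; rewrite rmorph1 mmapC divr1 oner_neq0.
- by exists 'X_j, 1; rewrite rmorph1 mmapX mmap1U divr1 oner_neq0.
- exists (n1 * d2 - n2 * d1), (d1 * d2); rewrite rmorphB !rmorphM mulf_neq0 //.
  by split=> //; rewrite -[in LHS]mulNr addf_div // mulNr.
(* A quotient by zero is 0 by convention, and is represented by 0 / 1. *)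
- have [n20|n20] := eqVneq (mmap emb w n2) 0.
    exists 0, 1; rewrite rmorph1 oner_neq0 raddf0; split=> //.
    by rewrite n20 mul0r invr0 mulr0 mul0r.
  exists (n1 * d2), (d1 * n2); rewrite !rmorphM mulf_neq0 //.
  by split=> //; rewrite invf_div mulf_div.
Qed.

End Adjoin.

(** * Descent along a quadratic extension *)

Section QuadraticDescent.

Variables (K L F : fieldType) (embK : {rmorphism K -> F}) (embL : {rmorphism L -> F}).
Variables (alpha : F) (a : K) (rho : {rmorphism F -> F}) (G : seq F).
Hypothesis alpha_sqr : alpha ^+ 2 = embK a.
Hypothesis embL_split : forall c, exists c1 c2, embL c = embK c1 + alpha * embK c2.
Hypothesis rho_alpha : rho alpha = - alpha.
Hypothesis rhoK : forall c, rho (embK c) = embK c.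
Hypothesis rhoG : {in G, forall g, rho g = g}.

(** The set K(G) + alpha K(G) is closed under division, because the norm A'^2 - a B'^2 of a divisor
    A' + alpha B' lies in K(G). *)
Lemma adjoin_quadratic_split z : adjoin embL G z ->
  exists z1 z2, [/\ adjoin embK G z1, adjoin embK G z2 & z = z1 + alpha * z2].
Proof.
elim=> {z} [c|g Gg|z z' _ [A [B [GA GB ->]]] _ [A' [B' [GA' GB' ->]]]
                  |z z' _ [A [B [GA GB ->]]] _ [A' [B' [GA' GB' zE]]]].
- have [c1 [c2 ->]] := embL_split c.
  by exists (embK c1), (embK c2); split=> //; apply: adjoin_const.
- exists g, 0; rewrite mulr0 addr0; split=> //; first exact: adjoin_gen.
  exact: adjoin0.
- by exists (A - A'), (B - B'); split; [apply: adjoin_sub | apply: adjoin_sub | ring].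
- have [z'0|z'0] := eqVneq z' 0.
    by exists 0, 0; rewrite z'0 invr0 !mulr0 addr0; split=> //; apply: adjoin0.
  (* The conjugate of [z'] is its image under the injective map [rho], so it is nonzero and the norm
     is too. *)
  have rz'0 : A' - alpha * B' != 0.
    suff -> : A' - alpha * B' = rho z' by rewrite fmorph_eq0.
    rewrite zE rmorphD rmorphM rho_alpha.
    by rewrite !(adjoin_fixed rhoK rhoG) // mulNr.
  have NE : A' ^+ 2 - embK a * B' ^+ 2 = z' * (A' - alpha * B').
    by rewrite zE -alpha_sqr; ring.
  have GN : adjoin embK G (A' ^+ 2 - embK a * B' ^+ 2).
    apply: adjoin_sub; first exact: adjoinX.
    by apply: adjoinM; [apply: adjoin_const | apply: adjoinX].
  (* The components of (A + alpha B) / (A' + alpha B') after multiplying both terms by A' - alpha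
     B'. *)
  exists ((A * A' - embK a * (B * B')) / (A' ^+ 2 - embK a * B' ^+ 2)).
  exists ((B * A' - A * B') / (A' ^+ 2 - embK a * B' ^+ 2)).
  split.
  - apply: adjoin_div => //; apply: adjoin_sub; first exact: adjoinM.
    by apply: adjoinM; [apply: adjoin_const | apply: adjoinM].
  - by apply: adjoin_div => //; apply: adjoin_sub; apply: adjoinM.
  rewrite NE -alpha_sqr; move: z'0 rz'0; rewrite zE => z'0 rz'0.
  field; by apply/andP.
Qed.

(** Writing z = A + alpha B with A, B in K(G), the difference z - rho(z) is 2 alpha B, so invariance
    forces B = 0. *)
Lemma adjoin_quadratic_descent z : alpha != 0 -> (2 : F) != 0 ->
  adjoin embL G z -> rho z = z -> adjoin embK G z.
Proof.
move=> alpha0 two0 /adjoin_quadratic_split[A [B [GA GB ->]]].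
rewrite rmorphD rmorphM rho_alpha !(adjoin_fixed rhoK rhoG) // => e.
suff -> : B = 0 by rewrite mulr0 addr0.
apply/eqP; have : (2 * alpha) * B = A + alpha * B - (A + - alpha * B) by ring.
move/eqP; rewrite e subrr.
by rewrite !mulf_eq0 (negbTE two0) (negbTE alpha0).
Qed.

End QuadraticDescent.

(** * Invariants of signed permutations *)

(** The shape of [Delta] for an arbitrary family, so that it applies both to the elements y_j and to
    the formal variables ['X_j]. *)
Definition difference_product (R : comNzRingType) (n : nat) (y : 'I_n -> R) : R :=
  \prod_(i < n) \prod_(j < n | (i < j)%N) (y i - y j).

(** The product is a Vandermonde determinant, and permuting its columns multiplies it by the
    sign. *)
Lemma difference_product_perm (R : comNzRingType) (n : nat) (y : 'I_n -> R) (s : 'S_n) :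
  difference_product (fun j => y (s j)) = (-1) ^+ odd_perm s * difference_product y.
Proof.
(* The factors in [det_Vandermonde] are later point minus earlier point; negating the points
   restores the order used here. *)
have E (x : 'I_n -> R) :
    difference_product x = \det (Vandermonde n (\row_j - x j)).
  rewrite det_Vandermonde; apply: eq_bigr => i _; apply: eq_bigr => j _.
  by rewrite !mxE opprK addrC.
rewrite !E mulrC -odd_permV -det_perm -det_mulmx -col_permE; congr (\det _).
by apply/matrixP => i j; rewrite !mxE.
Qed.

Lemma rmorph_difference_product (R S : comNzRingType) (phi : {rmorphism R -> S})
    (n : nat) (y : 'I_n -> R) :
  phi (difference_product y) = difference_product (phi \o y).
Proof.
rewrite rmorph_prod; apply: eq_bigr => i _; rewrite rmorph_prod.
by apply: eq_bigr => j _; rewrite rmorphB.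
Qed.

Lemma difference_product_neq0 (F : fieldType) (n : nat) (y : 'I_n -> F) :
  injective y -> difference_product y != 0.
Proof.
move=> y_inj; apply/prodf_neq0 => i _; apply/prodf_neq0 => j ltij.
by rewrite subr_eq0 (inj_eq y_inj) -val_eqE /= ltn_eqF.
Qed.

Lemma mmap_mesym (n : nat) (R S : comNzRingType) (emb : {rmorphism R -> S})
    (y : 'I_n -> S) (k : nat) :
  mmap emb y (mesym n R k) = \sum_(h : {set 'I_n} | #|h| == k) \prod_(i in h) y i.
Proof.
rewrite rmorph_sum; apply: eq_bigr => h _; rewrite rmorph_prod.
by apply: eq_bigr => i _; rewrite /= mmapX mmap1U.
Qed.

Lemma meval_mesym (n : nat) (R : comNzRingType) (y : 'I_n -> R) (k : nat) :
  (mesym n R k).@[y] = \sum_(h : {set 'I_n} | #|h| == k) \prod_(i in h) y i.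
Proof. exact: (mmap_mesym idfun). Qed.

(** By the fundamental theorem, [p] is a polynomial over K in the elementary symmetric
    polynomials. *)
Lemma symmetric_adjoin (K F : fieldType) (n : nat) (emb : {rmorphism K -> F})
    (y : 'I_n -> F) (G : seq F) (p : {mpoly K[n]}) :
  (forall k, (1 <= k <= n)%N -> adjoin emb G (mesym n F k).@[y]) ->
  p \is symmetric -> adjoin emb G (mmap emb y p).
Proof.
move=> Ge /sym_fundamental[q [<- _]]; rewrite /comp_mpoly mmap_rmorph.
rewrite (@eq_mmap _ _ _ _ emb _ (mmap emb y \o tnth [tuple mesym n K i.+1 | i < n])) //.
  apply: adjoin_mmap => j /=; rewrite tnth_mktuple mmap_mesym -meval_mesym.
  by apply: Ge; rewrite ltn_ord.
by move=> c /=; rewrite mmapC.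
Qed.

Lemma msym_difference_product (R : comNzRingType) (n : nat) (s : 'S_n) :
  let dX := difference_product (fun j => 'X_j : {mpoly R[n]}) in
  msym s dX = (-1) ^+ odd_perm s * dX.
Proof.
rewrite /= -difference_product_perm [LHS]rmorph_difference_product.
rewrite /difference_product; apply: eq_bigr => i _; apply: eq_bigr => j _.
by rewrite /= /msym !mmapX !mmap1U.
Qed.

Lemma mmap_difference_product (n : nat) (R S : comNzRingType) (emb : {rmorphism R -> S})
    (y : 'I_n -> S) :
  mmap emb y (difference_product (fun j => 'X_j)) = difference_product y.
Proof.
rewrite rmorph_difference_product /difference_product.
by apply: eq_bigr => i _; apply: eq_bigr => j _; rewrite /= !mmapX !mmap1U.
Qed.

(** The sign of a permutation squares to 1, so the square is the value of a symmetric polynomial. *)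
Lemma difference_product_sqr_adjoin (K F : fieldType) (n : nat) (emb : {rmorphism K -> F})
    (y : 'I_n -> F) (G : seq F) :
  (forall k, (1 <= k <= n)%N -> adjoin emb G (mesym n F k).@[y]) ->
  adjoin emb G (difference_product y ^+ 2).
Proof.
move=> Ge; rewrite -(mmap_difference_product emb) -rmorphXn.
apply: symmetric_adjoin Ge _; apply/issymP => s.
rewrite rmorphXn /= msym_difference_product exprMn -exprM mulnC exprM sqrrN.
by rewrite !expr1n mul1r.
Qed.

Lemma mmap_homog (n d : nat) (R S : comNzRingType) (emb : {rmorphism R -> S})
    (y : 'I_n -> S) (c : S) (p : {mpoly R[n]}) :
  p \is d.-homog -> mmap emb (fun j => c * y j) p = c ^+ d * mmap emb y p.
Proof.
move=> /dhomogP hp; rewrite /mmap big_distrr /= !big_seq; apply: eq_bigr => m pm.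
rewrite mulrCA -(hp m pm); congr (_ * _).
rewrite /mmap1 (eq_bigr _ (fun i _ => exprMn _ _ _)) big_split /=; congr (_ * _).
by rewrite prodrXr mdegE.
Qed.

(* The twisted action of s, read on the polynomials in the coordinates z_j. *)
Definition sign_perm_subst (R : comNzRingType) (n : nat) (s : 'S_n) :=
  mmap (@mpolyC n R) (fun j => (-1) ^+ odd_perm s * 'X_(s j)).

HB.instance Definition _ (R : comNzRingType) (n : nat) (s : 'S_n) :=
  GRing.RMorphism.copy (@sign_perm_subst R n s)
    (mmap (@mpolyC n R) (fun j => (-1) ^+ odd_perm s * 'X_(s j))).

Lemma sign_perm_substX (R : comNzRingType) (n : nat) (s : 'S_n) (m : 'X_{1..n}) :
  sign_perm_subst s 'X_[m] = ((-1) ^+ (odd_perm s * mdeg m) : R) *: msym s 'X_[m].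
Proof.
rewrite /sign_perm_subst (mmap_homog (d := mdeg m)); last by rewrite dhomogX.
by rewrite -mul_mpolyC exprM !rmorphXn rmorphN rmorph1.
Qed.

(** The substitution preserves degrees, and in degree d each monomial picks up the sign d times.
    Invariance can therefore be tested on homogeneous parts. *)
Lemma pihomog_sign_perm_subst (R : comNzRingType) (n d : nat) (s : 'S_n)
    (p : {mpoly R[n]}) :
  pihomog mdeg d (sign_perm_subst s p) =
    ((-1) ^+ (odd_perm s * d) : R) *: msym s (pihomog mdeg d p).
Proof.
rewrite msym_pihomog [p in LHS]mpolyE [p in RHS]mpolyE.
rewrite rmorph_sum [msym s _]linear_sum.
rewrite ![pihomog _ _ (\sum_(_ <- _) _)]linear_sum scaler_sumr.
apply: eq_bigr => m _ /=; rewrite [msym s _]linearZ /= !linearZ /=.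
rewrite -mul_mpolyC rmorphM /= [sign_perm_subst s _%:MP]mmapC mul_mpolyC.
rewrite sign_perm_substX !linearZ /=.
rewrite -msym_pihomog pihomogX; case: (mdeg m =P d) => [->|_].
  by rewrite !scalerA mulrC.
by rewrite !raddf0.
Qed.

(** * The fixed field of the signed permutation action *)

Section TwistedInvariants.

Variables (K F : fieldType) (n : nat) (emb : {rmorphism K -> F}).
Variables (z y : 'I_n -> F) (c : F).
Variables (sigma : 'S_n -> {rmorphism F -> F}) (G : seq F).
Hypothesis yE : forall j, y j = z j / c.
Hypothesis z_indep : alg_indep emb z.
Hypothesis z_generates : forall q : F, exists num den : {mpoly K[n]},
  mmap emb z den != 0 /\ q = mmap emb z num / mmap emb z den.
Hypothesis c_neq0 : c != 0.
Hypothesis sigma_const : forall s e, sigma s (emb e) = emb e.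
Hypothesis sigma_z : forall (s : 'S_n) j, sigma s (z j) = (-1) ^+ odd_perm s * z (s j).
Hypothesis G_mesym : forall k, (1 <= k <= n)%N -> adjoin emb G (mesym n F k).@[y].
Hypothesis G_diff : adjoin emb G (c * difference_product y).

Lemma sigma_mmap (s : 'S_n) (p : {mpoly K[n]}) :
  sigma s (mmap emb z p) = mmap emb z (sign_perm_subst s p).
Proof.
rewrite /sign_perm_subst !mmap_rmorph; apply: eq_mmap => [e|j] /=.
  by rewrite mmapC sigma_const.
by rewrite sigma_z rmorphM rmorphXn rmorphN1 /= mmapX mmap1U.
Qed.

(** Products of permutations are read from left to right, [(s * t) j = t (s j)], whence the order of
    the factors. The two signs multiply to the sign of the product. *)
Lemma sigma_mul (s t : 'S_n) (q : F) : sigma t (sigma s q) = sigma (s * t)%g q.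
Proof.
have [num [den [_ ->]]] := z_generates q.
have E p : sigma t (sigma s (mmap emb z p)) = sigma (s * t)%g (mmap emb z p).
  rewrite !mmap_rmorph; apply: eq_mmap => [e|j] /=; first by rewrite !sigma_const.
  rewrite !sigma_z rmorphM rmorphXn rmorphN1 /= sigma_z permM mulrA; congr (_ * _).
  by rewrite odd_permM signr_addb.
by rewrite !fmorph_div !E.
Qed.

(** If two of the z_j coincided, the polynomial ['X_i - 'X_j] would vanish at [z], against
    independence. *)
Lemma diff_neq0 : difference_product y != 0.
Proof.
apply: difference_product_neq0 => i j; rewrite !yE => /(divIf c_neq0) eq_z.
apply/eqP; apply: contraT => neq_ij.
have /eqP : 'X_i - 'X_j = 0 :> {mpoly K[n]}.
  by apply: z_indep; rewrite rmorphB /= !mmapX !mmap1U eq_z subrr.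
rewrite subr_eq0 => /eqP/(congr1 (fun p : {mpoly K[n]} => p@_U_(i)%MM))/eqP.
by rewrite !mcoeffX !eq_mnm1 eqxx [j == i]eq_sym (negbTE neq_ij) oner_eq0.
Qed.

(** By homogeneity p(z) = c^d p(y). With D the difference product of [y], c^2 = (c D)^2 / D^2 lies
    in the generated field, so only the parity of d matters. For even d, [p] is symmetric. For odd
    d, [p] times the formal difference product is symmetric, and c p(y) = (c D) (p(y) D) / D^2. *)
Lemma homog_invariant_adjoin (d : nat) (p : {mpoly K[n]}) : p \is d.-homog ->
  (forall s : 'S_n, (-1) ^+ (odd_perm s * d) *: msym s p = p) ->
  adjoin emb G (mmap emb z p).
Proof.
move=> p_homog p_inv.
have GdX2 := difference_product_sqr_adjoin G_mesym.
have Gc2 : adjoin emb G (c ^+ 2).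
  have -> : c ^+ 2 = (c * difference_product y) ^+ 2 / difference_product y ^+ 2.
    by rewrite exprMn mulfK // expf_neq0 // diff_neq0.
  by apply: adjoin_div => //; apply: adjoinX.
have -> : mmap emb z p = c ^+ d * mmap emb y p.
  rewrite -(mmap_homog _ _ _ p_homog); apply: eq_mmap => // j.
  by rewrite yE mulrC divfK.
have -> : c ^+ d = (c ^+ 2) ^+ d./2 * c ^+ odd d.
  by rewrite -exprM -exprD mul2n addnC odd_double_half.
rewrite -mulrA; apply: adjoinM; first exact: adjoinX.
have sgnd (s : 'S_n) : (-1) ^+ (odd_perm s * d) = (-1) ^+ (odd_perm s && odd d) :> K.
  by rewrite -signr_odd oddM oddb.
have [d_odd|d_even] := boolP (odd d); last first.
  rewrite mul1r; apply: symmetric_adjoin G_mesym _; apply/issymP => s.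
  by rewrite -[RHS](p_inv s) sgnd (negbTE d_even) andbF scale1r.
have pdX_sym : p * difference_product (fun j => 'X_j)  \is symmetric.
  apply/issymP => s; rewrite msymM msym_difference_product -[in RHS](p_inv s).
  rewrite sgnd d_odd andbT.
  by rewrite mulrCA mulrA -mul_mpolyC rmorphXn rmorphN1.
have -> : c ^+ true * mmap emb y p =
    c * difference_product y * mmap emb y (p * difference_product (fun j => 'X_j)) /
      difference_product y ^+ 2.
  rewrite rmorphM /= mmap_difference_product.
  by move: diff_neq0 (mmap _ _ p) => d0 e; field.
apply: adjoin_div => //; apply: adjoinM => //.
exact: symmetric_adjoin G_mesym pdX_sym.
Qed.

(** Independence of [z] turns invariance of the value into invariance of the polynomial, which then
    passes to each homogeneous part. *)
Lemma poly_invariant_adjoin (p : {mpoly K[n]}) :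
  (forall s, sigma s (mmap emb z p) = mmap emb z p) -> adjoin emb G (mmap emb z p).
Proof.
move=> p_inv.
have act_p s : sign_perm_subst s p = p.
  apply/eqP; rewrite -subr_eq0; apply/eqP/z_indep.
  by rewrite rmorphB /= -sigma_mmap p_inv subrr.
rewrite [p](@pihomog_partitionE _ _ mdeg (msize p)) // rmorph_sum /=.
apply: adjoin_sum => d _; apply: (@homog_invariant_adjoin d); first exact: pihomogP.
by move=> s; rewrite -pihomog_sign_perm_subst act_p.
Qed.

(* The product of the conjugates of a denominator is invariant, which makes the
   numerator invariant as well. *)
Lemma twisted_invariant_adjoin (q : F) : (forall s, sigma s q = q) -> adjoin emb G q.
Proof.
move=> q_inv; have [num [den [den0 qE]]] := z_generates q.
pose D := \prod_(s : 'S_n) sign_perm_subst s den.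
pose N := num * \prod_(s : 'S_n | s != 1%g) sign_perm_subst s den.
have DE : mmap emb z D = \prod_(s : 'S_n) sigma s (mmap emb z den).
  by rewrite rmorph_prod; apply: eq_bigr => s _; rewrite sigma_mmap.
have D0 : mmap emb z D != 0.
  by rewrite DE; apply/prodf_neq0 => s _; rewrite fmorph_eq0.
have D_inv t : sigma t (mmap emb z D) = mmap emb z D.
  (* Applying [sigma t] sends the conjugate indexed by s to the one indexed by s t, and so only
     permutes the factors. *)
  rewrite DE rmorph_prod [RHS](reindex_inj (mulIg t)).
  by apply: eq_bigr => s _; rewrite sigma_mul.
have act1 : sign_perm_subst 1 den = den.
  rewrite -[RHS]msym1m; apply: eq_mmap => // j.
  by rewrite odd_perm1 mul1r.
have NE : mmap emb z N = q * mmap emb z D.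
  have -> : D = den * \prod_(s : 'S_n | s != 1%g) sign_perm_subst s den.
    by rewrite /D (bigD1 1%g) //= act1.
  by rewrite !rmorphM /= qE mulrA divfK.
have N_inv t : sigma t (mmap emb z N) = mmap emb z N.
  by rewrite NE rmorphM /= q_inv D_inv.
rewrite -(mulfK D0 q) -NE.
by apply: adjoin_div; apply: poly_invariant_adjoin.
Qed.

End TwistedInvariants.

(** * Elementary symmetric functions of reciprocals *)

(** Each index belongs to n - 1 pairs, as the smaller member or as the larger one. *)
Lemma prod_pairs_mul (R : comNzRingType) (n : nat) (g : 'I_n -> R) :
  \prod_(i < n) \prod_(j < n | (i < j)%N) (g i * g j) = (\prod_(i < n) g i) ^+ n.-1.
Proof.
rewrite (eq_bigr _ (fun i _ => big_split _ _ _ _ _)) big_split /=.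
rewrite [X in _ * X](exchange_big_dep predT) //= -big_split /= -prodrXl.
apply: eq_bigr => i _.
have -> : g i ^+ n.-1 = \prod_(j < n | j != i) g i.
  by rewrite prodr_const cardC1 card_ord.
rewrite [RHS](bigID (fun j : 'I_n => (i < j)%N)) /=.
by congr (_ * _); apply: eq_bigl => j; rewrite -val_eqE /=; case: (ltngtP i j).
Qed.

Lemma prod_pairs_const (R : comNzRingType) (n : nat) (c : R) :
  \prod_(i < n) \prod_(j < n | (i < j)%N) c = c ^+ (n * n.-1)./2.
Proof.
rewrite (exchange_big_dep predT) //= -bin2 -bin2_sum big_mkord -prodrXr.
apply: eq_bigr => j _; rewrite (big_ord_narrow (ltnW (ltn_ord j))).
by rewrite prodr_const card_ord.
Qed.

Lemma mesym_scale (R : comNzRingType) (n k : nat) (c : R) (y : 'I_n -> R) :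
  (mesym n R k).@[fun j => c * y j] = c ^+ k * (mesym n R k).@[y].
Proof. exact/mmap_homog/dhomog_mesym. Qed.

Lemma mesym_last (R : comNzRingType) (n : nat) (y : 'I_n -> R) :
  (mesym n R n).@[y] = \prod_i y i.
Proof.
rewrite mesymnnE rmorph_prod; apply: eq_bigr => i _.
exact: mevalXU.
Qed.

Lemma mesym_first (R : comNzRingType) (n : nat) (y : 'I_n -> R) :
  (mesym n R 1).@[y] = \sum_i y i.
Proof.
rewrite mesym1E rmorph_sum; apply: eq_bigr => i _.
exact: mevalXU.
Qed.

(** Multiplying a product of reciprocals over a k-subset by the product of all y_j leaves the
    product over the complement. *)
Lemma mesym_inv (F : fieldType) (n k : nat) (y : 'I_n -> F) :
  (forall j, y j != 0) -> (k <= n)%N ->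
  (mesym n F k).@[fun j => (y j)^-1] = (mesym n F (n - k)).@[y] / (mesym n F n).@[y].
Proof.
move=> y0 le_kn; have P0 : \prod_i y i != 0 by apply/prodf_neq0 => i _.
apply: (canRL (mulfK _)); rewrite mesym_last //.
rewrite !meval_mesym mulr_suml [RHS](reindex_inj (@setC_inj _)).
apply: eq_big => h.
  rewrite [#|~: h|]cardsCs setCK card_ord.
  have : (#|h| <= n)%N by rewrite -[n in (_ <= n)%N]card_ord max_card.
  by move=> le_hn; apply/eqP/eqP => [->|e] //; rewrite -[LHS](subKn le_hn) e subKn.
move=> _; rewrite (bigID (mem h) predT) /= mulrA -big_split /=.
rewrite big1 ?mul1r => [|i _]; last by rewrite mulVf.
by apply: eq_bigl => i; rewrite inE.
Qed.

(** * The involution that inverts the z_j *)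

Section Reciprocal.

Variables (F : fieldType) (n : nat) (rho : {rmorphism F -> F}).
Variables (z y : 'I_n -> F) (c w : F).
Local Notation t k := ((mesym n F k).@[y]).
Hypothesis yE : forall j, y j = z j / c.
Hypothesis wE : w = t n / t n.-1.
Hypothesis n_gt0 : (0 < n)%N.
Hypothesis cE : c = \sum_j z j.
Hypothesis c_neq0 : c != 0.
Hypothesis z_neq0 : forall j, z j != 0.
Hypothesis t_neq0 : forall k, (k <= n)%N -> t k != 0.
Hypothesis rho_z : forall j, rho (z j) = (z j)^-1.

Let tn_neq0 : t n != 0. Proof. exact: t_neq0. Qed.
Let tp_neq0 : t n.-1 != 0. Proof. exact/t_neq0/leq_pred. Qed.
Let w_neq0 : w != 0. Proof. by rewrite wE mulf_neq0 ?invr_eq0. Qed.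
Let y_neq0 j : y j != 0. Proof. by rewrite yE mulf_neq0 ?invr_eq0. Qed.

Lemma mesym_first_normalized : t 1 = 1.
Proof. by rewrite mesym_first (eq_bigr _ (fun j _ => yE j)) -mulr_suml -cE divff. Qed.

(** The sum of the 1 / y_j equals [c * rho c], and by [mesym_inv] it also equals t_(n-1) / t_n = 1 /
    w. *)
Lemma rho_sum : rho c = (c * w)^-1.
Proof.
have := mesym_inv y_neq0 n_gt0; rewrite mesym_first subn1.
have -> : \sum_j (y j)^-1 = c * rho c.
  rewrite [in rho c]cE rmorph_sum mulr_sumr; apply: eq_bigr => j _.
  by rewrite rho_z yE invf_div.
by move=> e; rewrite invfM wE invf_div -e mulKf.
Qed.

Lemma rho_y j : rho (y j) = w / y j.
Proof. by rewrite !yE fmorph_div rho_z rho_sum invrK; field; rewrite c_neq0 z_neq0. Qed.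

(** Since rho(y_j) = w / y_j, homogeneity contributes w^k and the reciprocals contribute t_(n-k) /
    t_n. For k = i + 1 this is the expression t_(n-(i+1)) t_n^i / t_(n-1)^(i+1) for u_(n-i). *)
Lemma rho_mesym k : (k <= n)%N -> rho (t k) = w ^+ k * t (n - k) / t n.
Proof.
move=> le_kn; rewrite -mulrA -mesym_inv // -mesym_scale !meval_mesym rmorph_sum.
by apply: eq_bigr => h _; rewrite rmorph_prod; apply: eq_bigr => j _; apply: rho_y.
Qed.

(** The images of t_n and t_(n-1) are w^n t_0 / t_n and w^(n-1) t_1 / t_n, with t_0 = t_1 = 1. *)
Lemma rho_w : rho w = w.
Proof.
have t1 := mesym_first_normalized.
rewrite [in LHS]wE fmorph_div !rho_mesym ?leq_pred // subnn mesym0E meval1.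
have -> : (n - n.-1 = 1)%N by rewrite -subn1 subKn.
have e : w ^+ n = w * w ^+ n.-1 by rewrite -exprS prednK.
by rewrite t1 e; field; rewrite tn_neq0 expf_neq0.
Qed.

(** Factor by factor, w / y_i - w / y_j = - w (y_i - y_j) / (y_i y_j). *)
Lemma rho_difference_product :
  rho (difference_product y) =
    (- w) ^+ (n * n.-1)./2 / t n ^+ n.-1 * difference_product y.
Proof.
have -> : t n ^+ n.-1 = \prod_(i < n) \prod_(j < n | (i < j)%N) (y i * y j).
  by rewrite prod_pairs_mul mesym_last.
rewrite -prod_pairs_const rmorph_difference_product /difference_product.
rewrite -prodf_div -big_split; apply: eq_bigr => i _ /=.
rewrite -prodf_div -big_split; apply: eq_bigr => j _ /=.
by rewrite !rho_y; field; rewrite !y_neq0.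
Qed.

Lemma norm_difference_product : (2 <= n)%N ->
  let Z := c * difference_product y in
  Z * rho Z = (-1) ^+ (n * n.-1)./2 * (t n) ^- n.-1
    * w ^+ (n.+1 * (n - 2))./2 * difference_product y ^+ 2.
Proof.
move=> n_ge2 /=; rewrite rmorphM rho_sum rho_difference_product.
(* The factor 1 / w coming from [c * rho c] cancels one of the n(n-1)/2 factors w in the image of
   the difference product, which leaves the exponent (n+1)(n-2)/2. *)
have -> : (n * n.-1)./2 = (n.+1 * (n - 2))./2.+1.
  case: n n_ge2 => [|[|k]] // _.
  by have -> : (k.+2 * k.+2.-1 = (k.+3 * (k.+2 - 2)).+2)%N by rewrite subn2 /=; nia.
move: (_ * _)./2 => e; rewrite [(- w) ^+ _]exprNn [w ^+ _.+1]exprS; field.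
by rewrite c_neq0 w_neq0 expf_neq0.
Qed.

(* When n = 2m + 1, w is read off the values of rho on t_m and t_(m+1). *)
Lemma mesym_adjoin (K : fieldType) (emb : {rmorphism K -> F}) (G : seq F) :
  (2 <= n)%N -> (~~ odd n -> adjoin emb G w) ->
  (forall k, (2 <= k <= uphalf n)%N -> adjoin emb G (t k) /\ adjoin emb G (rho (t k))) ->
  forall k, (k <= n)%N -> adjoin emb G (t k).
Proof.
move=> n_ge2 Gw Gt; set N := uphalf n in Gt *.
(* The range extends down to k = 0 and k = 1, where t_k = 1. *)
have Gt' k : (k <= N)%N -> adjoin emb G (t k) /\ adjoin emb G (rho (t k)).
  case: k => [|[|k]] le_kN; last exact: Gt.
    by rewrite mesym0E meval1 rmorph1; split; apply: adjoin1.
  by rewrite mesym_first_normalized rmorph1; split; apply: adjoin1.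
pose m := n./2.
have le_mn : (m <= n)%N by rewrite /m; lia.
have le_mN : (m <= N)%N by rewrite /N uphalf_half leq_addl.
have [Gtm Grtm] := Gt' m le_mN.
have rtm := rho_mesym le_mn.
have rtm0 : rho (t m) != 0 by rewrite fmorph_eq0 t_neq0.
have [Gw' Gtn] : adjoin emb G w /\ adjoin emb G (t n).
  have [n_odd|n_even] := boolP (odd n).
    have nE : n = (m + m.+1)%N by rewrite -[n in LHS]odd_double_half n_odd -addnn addnS.
    have NE : N = m.+1 by rewrite /N uphalf_half n_odd.
    have [GtS GrtS] := Gt' m.+1 (eq_leq (esym NE)).
    have le_Sn : (m.+1 <= n)%N by rewrite nE leq_addl.
    have rtS := rho_mesym le_Sn.
    have tm0 := t_neq0 le_mn; have tS0 := t_neq0 le_Sn.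
    have e1 : (n - m = m.+1)%N by rewrite nE addKn.
    have e2 : (n - m.+1 = m)%N by rewrite nE addnK.
    rewrite e1 in rtm; rewrite e2 in rtS.
    have Gw' : adjoin emb G w.
      (* From rho(t_m) = w^m t_(m+1) / t_n and rho(t_(m+1)) = w^(m+1) t_m / t_n, the quotient of the
         second by the first is w t_m / t_(m+1). *)
      have -> : w = rho (t m.+1) * t m.+1 / (t m * rho (t m)).
        rewrite rtm rtS exprS; field.
        by rewrite tn_neq0 tS0 expf_neq0 // tm0.
      by apply: adjoin_div; apply: adjoinM.
    split=> //; have -> : t n = w ^+ m * t m.+1 / rho (t m).
      rewrite rtm; field.
      by rewrite tn_neq0 tS0 expf_neq0.
    by apply: adjoin_div => //; apply: adjoinM => //; apply: adjoinX.
  have Gw' := Gw n_even; split=> //.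
  have nE : n = (m + m)%N by rewrite -[n in LHS]odd_double_half (negbTE n_even) -addnn.
  have e1 : (n - m = m)%N by rewrite [in LHS]nE addKn.
  rewrite e1 in rtm; have tm0 := t_neq0 le_mn.
  have -> : t n = w ^+ m * t m / rho (t m).
    by rewrite rtm; field; rewrite tn_neq0 tm0 expf_neq0.
  by apply: adjoin_div => //; apply: adjoinM => //; apply: adjoinX.
move=> k le_kn; have [/Gt'[] //|lt_Nk] := leqP k N.
have le_nkN : (n - k <= N)%N.
  rewrite leq_subLR -[leqLHS]odd_double_half; move: lt_Nk; rewrite /N uphalf_half -addnn.
  lia.
have [_ Grt] := Gt' _ le_nkN.
(* The upper half of the t_k comes from [rho] on the lower half, once w and t_n are available. *)
have -> : t k = rho (t (n - k)) * t n / w ^+ (n - k).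
  rewrite rho_mesym ?leq_subr // subKn //; field.
  by rewrite tn_neq0 expf_neq0.
by apply: adjoin_div; [apply: adjoinM | apply: adjoinX].
Qed.

End Reciprocal.

(** * The twisted action *)

Lemma rfCX_neq0 (K : fieldType) (n : nat) (c : K) (j : 'I_n) : rfC n c + rfX K j != 0.
Proof.
rewrite -tofracD tofrac_eq0; apply/eqP => /(congr1 (fun p : {mpoly K[n]} => p@_U_(j)%MM)).
rewrite mcoeffD mcoeffC mcoeffX eqxx mnm1_eq0 mulr0 add0r mcoeff0 => /eqP.
by rewrite oner_eq0.
Qed.

Lemma rfX_neq0 (K : fieldType) (n : nat) (j : 'I_n) : rfX K j != 0.
Proof. by rewrite -[rfX K j]add0r -(rmorph0 (@rfC K n)) rfCX_neq0. Qed.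

(** The inverse substitution is the one of s^-1, which has the same sign as s; in the odd case this
    uses that x -> a / x is an involution. *)
Lemma twisted_var_indep (K : fieldType) (a : K) (n : nat) (s : 'S_n) :
  a != 0 -> alg_indep (@rfC K n) (twisted_var a s).
Proof.
move=> a0; have ra0 : rfC n a != 0 by rewrite fmorph_eq0.
rewrite /twisted_var; case: (odd_perm s).
  refine (@invertible_subst_indep K n (fun=> a%:MP) (fun j => 'X_(s j)) _
    (fun j => rfC n a / rfX K (s^-1%g j)) _ _ _ _) => j.
  - by rewrite -tofrac_eq0 rfX_neq0.
  - by [].
  - by rewrite mmapX mmap1U permK mulf_neq0 ?invr_eq0 ?rfX_neq0.
  - by rewrite mmapX mmap1U mmapC permK invf_div mulrC divfK.
refine (@invertible_subst_indep K n (fun j => 'X_(s j)) (fun=> 1) _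
  (fun j => rfX K (s^-1%g j)) _ _ _ _) => j.
- exact: oner_neq0.
- by rewrite tofrac1 divr1.
- by rewrite rmorph1 oner_neq0.
- by rewrite rmorph1 divr1 mmapX mmap1U permK.
Qed.

Lemma twisted_act_rmorph (K : fieldType) (a : K) (n : nat) (s : 'S_n) : a != 0 ->
  {phi : {rmorphism ratfun K n -> ratfun K n} |
    [/\ twisted_act a s =1 phi, forall c, phi (rfC n c) = rfC n c
      & forall j, phi (rfX K j) = twisted_var a s j]}.
Proof. by move=> a0; apply: rf_subst_rmorph; apply: twisted_var_indep. Qed.

Lemma mobius_involutive (F : fieldType) (b x : F) :
  (2 : F) != 0 -> b != 0 -> 1 + x != 0 ->
  let x' := b * ((1 - x) / (1 + x)) in b + x' != 0 /\ (b - x') / (b + x') = x.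
Proof.
move=> two0 b0 x10 x'.
have E : b + x' = 2 * b / (1 + x) by rewrite /x'; field.
have nz : 2 * b / (1 + x) != 0 by rewrite !mulf_neq0 ?invr_eq0.
by rewrite E; split=> //; rewrite /x'; field; rewrite x10 b0 two0.
Qed.

Lemma mobius_inverse (F : fieldType) (b x : F) :
  (2 : F) != 0 -> b != 0 -> b + x != 0 ->
  x = b * ((1 - (b - x) / (b + x)) / (1 + (b - x) / (b + x))).
Proof.
move=> two0 b0 bx0; have -> : 1 + (b - x) / (b + x) = 2 * b / (b + x) by field.
by field; rewrite bx0 b0 two0.
Qed.

(** With b = alpha and b^2 = a, replacing x by a / x negates (alpha - x) / (alpha + x). This is the
    source of the sign in the action on the z_j. *)
Lemma mobius_reciprocal (F : fieldType) (b x : F) : b != 0 -> x != 0 -> b + x != 0 ->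
  (b - b ^+ 2 / x) / (b + b ^+ 2 / x) = - ((b - x) / (b + x)).
Proof.
move=> b0 x0 bx0; have -> : b + b ^+ 2 / x = b * (b + x) / x by field.
by field; rewrite bx0 x0 b0.
Qed.

(** Recovers the pair u_i, u_(n-i) from v_i, v_(n-i), at the price of dividing by alpha. *)
Lemma half_sum_difference (F : fieldType) (b x y : F) : (2 : F) != 0 -> b != 0 ->
  x = (x + y) / 2 + b * (x - y) / 2 / b /\ y = (x + y) / 2 - b * (x - y) / 2 / b.
Proof. by move=> two0 b0; split; field; rewrite b0 two0. Qed.

Lemma quadratic_norm (F : fieldType) (b x y : F) : (2 : F) != 0 -> b != 0 ->
  ((x + y) / 2) ^+ 2 - b ^+ 2 * ((x - y) / (2 * b)) ^+ 2 = x * y.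
Proof. by move=> two0 b0; field; rewrite b0 two0. Qed.

Lemma quadratic_recover (F : fieldType) (b x y : F) : (2 : F) != 0 -> b != 0 ->
  x = (x + y) / 2 + b * ((x - y) / (2 * b)).
Proof. by move=> two0 b0; field; rewrite b0 two0. Qed.

(** * Rational functions over L = K(alpha) and the coordinates z_j *)

Section Concrete.

Variables (K : fieldType) (char_neq2 : 2%N \notin [pchar K]).
Variables (a : K) (a_neq0 : a != 0) (L : fieldExtType K) (alpha : L).
Hypothesis alpha_sqr : alpha ^+ 2 = a%:A.
Hypothesis L_gen : <<1; alpha>>%VS = fullv.
Variable rhoL : {lrmorphism L -> L}.
Hypothesis conj_alpha : rhoL alpha = - alpha.
Variable n : nat.
Local Notation M := (ratfun L n).
Local Notation al := (rfC n alpha).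
Local Notation z := (@zvar K L alpha n).

Lemma two_neq0 (F : fieldType) (phi : {rmorphism K -> F}) : (2 : F) != 0.
Proof.
rewrite -(rmorph_nat phi) fmorph_eq0; apply: contraNneq char_neq2 => two0.
by rewrite inE /= two0 eqxx.
Qed.

Lemma alpha_neq0 : alpha != 0.
Proof. by rewrite -sqrf_eq0 alpha_sqr scaler_eq0 oner_eq0 orbF. Qed.

Lemma al_neq0 : al != 0.
Proof. by rewrite fmorph_eq0 alpha_neq0. Qed.

Lemma al_sqr : al ^+ 2 = baseC L n a.
Proof. by rewrite -rmorphXn /= alpha_sqr. Qed.

Lemma al_subX_neq0 (j : 'I_n) : al - rfX L j != 0.
Proof. by rewrite -oppr_eq0 opprB addrC -rmorphN rfCX_neq0. Qed.

(** Every element of L is a polynomial in alpha, and alpha^2 = a reduces each power to degree at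
    most one. *)
Lemma quadratic_split (c : L) : exists c1 c2 : K, c = c1%:A + alpha * c2%:A.
Proof.
have /Fadjoin_polyP[p /polyOverP p1 ->] : c \in <<1; alpha>>%VS by rewrite L_gen memvf.
have split_pow i : exists c1 c2 : K, alpha ^+ i = c1%:A + alpha * c2%:A.
  elim: i => [|i [c1 [c2 IHi]]].
    by exists 1, 0; rewrite scale1r scale0r mulr0 addr0.
  exists (a * c2), c1; rewrite exprS IHi mulrDr addrC mulrA -expr2 alpha_sqr.
  by rewrite mulr_algl scalerA.
rewrite horner_coef; elim/big_ind: _ => [|x y [c1 [c2 ->]] [d1 [d2 ->]]|i _].
- by exists 0, 0; rewrite !scale0r mulr0 addr0.
- by exists (c1 + d1), (c2 + d2); rewrite !scalerDl mulrDr addrACA.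
have /vlineP[k ->] := p1 i; have [c1 [c2 ->]] := split_pow i.
exists (k * c1), (k * c2).
by rewrite mulr_algl scalerDr scalerAr !scalerA.
Qed.

Lemma rhoL_alg (c : K) : rhoL c%:A = c%:A.
Proof. exact: rmorph_alg. Qed.

Lemma rhoL_involutive : involutive rhoL.
Proof.
move=> c; have [c1 [c2 ->]] := quadratic_split c.
rewrite !rmorphD !rmorphM /= !rhoL_alg; congr (_ + _ * _).
by rewrite [LHS](congr1 rhoL conj_alpha) rmorphN /= [rhoL _]conj_alpha opprK.
Qed.

Lemma incl_rmorph : {phi : {rmorphism ratfun K n -> M} |
  [/\ @incl K L n =1 phi, forall c, phi (rfC n c) = baseC L n c
    & forall j, phi (rfX K j) = rfX L j]}.
Proof.
by apply: (rf_subst_rmorph (emb := @baseC K L n)); exact (@rfX_indep K L n (in_alg L)).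
Qed.

Lemma rho_rmorph : {phi : {rmorphism M -> M} |
  [/\ @rho K L rhoL n =1 phi, forall c, phi (rfC n c) = rfC n (rhoL c)
    & forall j, phi (rfX L j) = rfX L j]}.
Proof.
by apply: (rf_subst_rmorph (emb := @rfC L n \o rhoL)); exact (@rfX_indep L L n rhoL).
Qed.

Lemma zvar_neq0 j : z j != 0.
Proof.
by apply: mulf_neq0; [apply: al_subX_neq0 | rewrite invr_eq0 rfCX_neq0].
Qed.

Lemma zvar_inv j : rfX L j = al * ((1 - z j) / (1 + z j)).
Proof.
exact: mobius_inverse (two_neq0 (@baseC K L n)) al_neq0 (rfCX_neq0 alpha j).
Qed.

(** The map x -> (alpha - x) / (alpha + x) has the inverse x -> alpha (1 - x) / (1 + x), so the
    substitution is invertible. *)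
Lemma zvar_indep : alg_indep (@rfC L n) z.
Proof.
have mob x := @mobius_involutive M al x (two_neq0 (@baseC K L n)) al_neq0.
have oneX j : 1 + rfX L j != 0 :> M by rewrite -(rmorph1 (@rfC L n)) rfCX_neq0.
refine (@invertible_subst_indep L n (fun j => alpha%:MP - 'X_j)
  (fun j => alpha%:MP + 'X_j) _
  (fun j => al * ((1 - rfX L j) / (1 + rfX L j))) _ _ _ _) => j.
- by rewrite -tofrac_eq0 tofracD rfCX_neq0.
- by rewrite tofracB tofracD.
- by rewrite mmapD mmapC mmapX mmap1U; case: (mob (rfX L j) (oneX j)).
- by rewrite mmapB mmapD mmapC mmapX mmap1U; case: (mob (rfX L j) (oneX j)).
Qed.

Lemma zvar_generates (q : M) : exists num den : {mpoly L[n]},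
  mmap (@rfC L n) z den != 0 /\ q = mmap (@rfC L n) z num / mmap (@rfC L n) z den.
Proof.
apply: (@adjoin_ratio L M (@rfC L n) [seq z j | j <- enum 'I_n]).
  by move=> g /mapP[j _ ->]; exists j.
have [num [den [_ ->]]] := ratfun_div q.
set G := map _ _; have Gx p : adjoin (@rfC L n) G (mmap (@rfC L n) (@rfX L n) p).
  apply: adjoin_mmap => j; rewrite zvar_inv; apply: adjoinM; first exact: adjoin_const.
  have Gz : adjoin (@rfC L n) G (z j) by apply/adjoin_gen/map_f; rewrite mem_enum.
  have G1 := adjoin1 (@rfC L n) G.
  by apply: adjoin_div; [apply: adjoin_sub | apply: adjoinD].
by rewrite -!mmap_rfX; apply: adjoin_div.
Qed.

Lemma z0_mmap : z0 alpha n = mmap (@rfC L n) z (mesym n L 1).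
Proof.
rewrite mesym1E rmorph_sum; apply: eq_bigr => j _.
by rewrite /= mmapX mmap1U.
Qed.

Lemma z0_neq0 : (0 < n)%N -> z0 alpha n != 0.
Proof.
move=> n_gt0; rewrite z0_mmap; apply: contraNneq (@mesym_neq0 n L 1 n_gt0) => e.
exact/eqP/zvar_indep.
Qed.

(** By scaling, t_k is e_k(z) / z_0^k, where e_k is the k-th elementary symmetric polynomial, and
    e_k(z) is nonzero by independence of the z_j. *)
Lemma t_neq0 k : (0 < n)%N -> (k <= n)%N -> t alpha n k != 0.
Proof.
move=> n_gt0 le_kn; rewrite /t.
have -> : (mesym n M k).@[yvar alpha (n:=n)] = (z0 alpha n) ^- k * (mesym n M k).@[z].
  rewrite -exprVn -mesym_scale; apply: meval_eq => j.
  by rewrite /yvar mulrC.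
apply: mulf_neq0; first by rewrite invr_eq0 expf_neq0 // z0_neq0.
rewrite meval_mesym -(mmap_mesym (@rfC L n)).
by apply: contraNneq (mesym_neq0 L le_kn) => e; apply/eqP/zvar_indep.
Qed.

Lemma rho_involutive : involutive (@rho K L rhoL n).
Proof.
have [phi [rhoE phiC phiX]] := rho_rmorph.
move=> q; rewrite !rhoE.
apply: (ratfun_rmorph_eq (phi := phi \o phi) (psi := idfun)) => [c|j] /=.
  by rewrite !phiC rhoL_involutive.
by rewrite !phiX.
Qed.

Lemma rho_zvar (phi : {rmorphism M -> M}) :
  (forall c, phi (rfC n c) = rfC n (rhoL c)) -> (forall j, phi (rfX L j) = rfX L j) ->
  forall j, phi (z j) = (z j)^-1.
Proof.
move=> phiC phiX j; rewrite fmorph_div rmorphB rmorphD phiC phiX conj_alpha rmorphN.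
rewrite invf_div -opprD [- al + _]addrC -[X in _ / X]opprB invrN mulrNN.
by [].
Qed.

Lemma aA_neq0 : a%:A != 0 :> L.
Proof. by rewrite scaler_eq0 oner_eq0 orbF. Qed.

Lemma twisted_zvar (s : 'S_n) (phi : {rmorphism M -> M}) :
  (forall c, phi (rfC n c) = rfC n c) ->
  (forall j, phi (rfX L j) = twisted_var a%:A s j) ->
  forall j, phi (z j) = (-1) ^+ odd_perm s * z (s j).
Proof.
move=> phiC phiX j; rewrite fmorph_div rmorphB rmorphD phiC phiX /twisted_var.
case: (odd_perm s); last by rewrite expr0 mul1r.
rewrite expr1 mulN1r -alpha_sqr rmorphXn /= /zvar.
exact: mobius_reciprocal al_neq0 (rfX_neq0 L (s j)) (rfCX_neq0 alpha (s j)).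
Qed.

(** Applied to three families of generators: the x_j, the v_k, and the v_k together with x and y. *)
Lemma rho_descent (G : seq M) (q : M) :
  {in G, forall g, rho rhoL g = g} -> adjoin (@rfC L n) G q -> rho rhoL q = q ->
  adjoin (@baseC K L n) G q.
Proof.
have [phi [rhoE phiC phiX]] := rho_rmorph.
move=> rhoG Gq rho_q.
apply: (@adjoin_quadratic_descent K L M _ (@rfC L n) al a phi) => //.
- exact: al_sqr.
- move=> c; have [c1 [c2 ->]] := quadratic_split c; exists c1, c2.
  by rewrite rmorphD rmorphM.
- by rewrite phiC conj_alpha rmorphN.
- by move=> c; rewrite phiC rhoL_alg.
- by move=> g Gg; rewrite -rhoE; apply: rhoG.
- exact: al_neq0.
- exact: two_neq0 (@baseC K L n).
- by rewrite -rhoE.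
Qed.

(* Galois descent: K(x) is the fixed field of rho in L(x), so the twisted
   invariants of K(x) are the elements of L(x) fixed by rho and by S_n. *)
Lemma twisted_fixedP (q : M) :
  (exists p : ratfun K n, twisted_fixed a p /\ q = incl L p) <->
  rho rhoL q = q /\ forall s : 'S_n, twisted_act a%:A s q = q.
Proof.
have [inc [inclE incC incX]] := incl_rmorph.
have [phi [rhoE phiC phiX]] := rho_rmorph.
have act_incl s p : twisted_act a%:A s (inc p) = inc (twisted_act a s p).
  have [tL [tLE tLC tLX]] := twisted_act_rmorph (n := n) s aA_neq0.
  have [tK [tKE tKC tKX]] := twisted_act_rmorph (n := n) s a_neq0.
  rewrite tLE tKE.
  apply: (ratfun_rmorph_eq (phi := tL \o inc) (psi := inc \o tK)) => [c|j] /=.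
    by rewrite tKC !incC tLC.
  rewrite incX tLX tKX /twisted_var; case: (odd_perm s); last by rewrite incX.
  by rewrite fmorph_div incX incC.
have rho_inc p : phi (inc p) = inc p.
  apply: (ratfun_rmorph_eq (phi := phi \o inc) (psi := inc)) => [c|j] /=.
    by rewrite incC phiC rhoL_alg.
  by rewrite incX phiX.
split=> [[p [p_fix ->]]|[rho_q q_fix]].
  rewrite inclE rhoE rho_inc; split=> // s.
  by rewrite act_incl p_fix.
have [p qE] : exists p, q = inc p.
  (* The variables generate L(x) over L and are fixed by [rho], so quadratic descent puts [q] in the
     subfield they generate over K. *)
  have : adjoin (@baseC K L n) [seq rfX L j | j <- enum 'I_n] q.
    apply: rho_descent => //; first by move=> g /mapP[j _ ->]; rewrite rhoE phiX.
    have [num [den [_ ->]]] := ratfun_div q.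
    rewrite -!mmap_rfX; apply: adjoin_div; apply: adjoin_mmap => j;
      by apply/adjoin_gen/map_f; rewrite mem_enum.
  elim=> {q rho_q q_fix} [c|g /mapP[j _ ->]|z1 z2 _ [p1 ->] _ [p2 ->]|
                         z1 z2 _ [p1 ->] _ [p2 ->]].
  - by exists (rfC n c); rewrite incC.
  - by exists (rfX K j); rewrite incX.
  - by exists (p1 - p2); rewrite rmorphB.
  - by exists (p1 / p2); rewrite fmorph_div.
exists p; split; last by rewrite inclE.
by move=> s; apply: (fmorph_inj inc); rewrite -act_incl -qE.
Qed.

(** The action moves only the variables and [rho] only the constants; the constant a in the twist
    lies in K and is fixed by [rho]. *)
Lemma twisted_act_rho (s : 'S_n) (q : M) :
  twisted_act a%:A s (rho rhoL q) = rho rhoL (twisted_act a%:A s q).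
Proof.
have [phi [rhoE phiC phiX]] := rho_rmorph.
have [tau [tauE tauC tauX]] := twisted_act_rmorph (n := n) s aA_neq0.
rewrite !rhoE !tauE.
apply: (ratfun_rmorph_eq (phi := tau \o phi) (psi := phi \o tau)) => [c|j] /=.
  by rewrite phiC !tauC phiC.
rewrite phiX tauX /twisted_var; case: (odd_perm s); last by rewrite phiX.
by rewrite fmorph_div phiX phiC rhoL_alg.
Qed.

(** * Invariance of the t_k and of Z under the symmetric group *)

Let Z : M := z0 alpha n * difference_product (@yvar K L alpha n).

Lemma twisted_act_z0 (s : 'S_n) :
  twisted_act a%:A s (z0 alpha n) = (-1) ^+ odd_perm s * z0 alpha n.
Proof.
have [tau [tauE tauC tauX]] := twisted_act_rmorph (n := n) s aA_neq0.
rewrite tauE rmorph_sum mulr_sumr [RHS](reindex_inj (@perm_inj _ s)).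
by apply: eq_bigr => j _; apply: twisted_zvar.
Qed.

Lemma twisted_act_yvar (s : 'S_n) (j : 'I_n) :
  twisted_act a%:A s (yvar alpha j) = yvar alpha (s j).
Proof.
have := twisted_act_z0 s.
have [tau [tauE tauC tauX]] := twisted_act_rmorph (n := n) s aA_neq0.
rewrite !tauE => e; rewrite fmorph_div e (twisted_zvar tauC tauX) -mulf_div.
by rewrite divff ?mul1r // signr_eq0.
Qed.

Lemma twisted_act_t (s : 'S_n) (k : nat) :
  twisted_act a%:A s (t alpha n k) = t alpha n k.
Proof.
have := twisted_act_yvar s.
have [tau [tauE tauC tauX]] := twisted_act_rmorph (n := n) s aA_neq0.
rewrite tauE => e; rewrite /t -[in RHS](issymP _ (mesym_sym n M k) s) !meval_mesym.
rewrite /msym [RHS](mmap_rmorph (mmap idfun (yvar alpha (n := n)))).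
rewrite (@eq_mmap _ _ _ _ idfun _ (fun j => yvar alpha (s j))) => [|c|j] /=.
- rewrite mmap_mesym rmorph_sum; apply: eq_bigr => h _; rewrite rmorph_prod.
  by apply: eq_bigr => j _; rewrite -tauE e.
- by rewrite mmapC.
- by rewrite mmapX mmap1U.
Qed.

(** The y_j are permuted without sign, so the difference product is multiplied by sgn(s), as z_0 is;
    the two signs cancel. *)
Lemma twisted_act_Z (s : 'S_n) : twisted_act a%:A s Z = Z.
Proof.
have := twisted_act_yvar s; have := twisted_act_z0 s.
have [tau [tauE tauC tauX]] := twisted_act_rmorph (n := n) s aA_neq0.
rewrite !tauE => e0 ey; rewrite rmorphM e0 rmorph_difference_product.
have -> : difference_product (tau \o yvar alpha (n := n)) =
    difference_product (fun j => yvar alpha (s j)).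
  apply: eq_bigr => i _; apply: eq_bigr => j _.
  by rewrite /= -!tauE !ey.
by rewrite difference_product_perm mulrACA -expr2 sqrr_sign mul1r.
Qed.

(** * The subfield generated by the v_k *)

Hypothesis n_ge2 : (2 <= n)%N.
Let n_gt0 : (0 < n)%N. Proof. exact: ltnW. Qed.

Local Notation T k := (t alpha n k).
Local Notation rh := (@rho K L rhoL n).
Local Notation vv k := (@v K L alpha rhoL n k).
Local Notation vs := [seq vv k | k <- iota 1 n.-1].

(** For positive k, the bound [k.*2 < n] means k <= m when n = 2m + 1 and k <= m - 1 when n = 2m, so
    both parities are handled together. *)
Lemma v_low k : (k.*2 < n)%N -> vv k = (T k.+1 + rh (T k.+1)) / 2.
Proof.
move=> lt_kn; rewrite /v /u.
have -> : ~~ odd n && (k == n./2) = false by lia.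
have -> : (k <= n./2)%N by lia.
have -> : ~~ odd n && (n - k == n./2)%N = false by lia.
have -> : (n - k <= n./2)%N = (k == 0)%N && (n == 0)%N by lia.
have -> : (n - (n - k) = k)%N by lia.
by rewrite (gtn_eqF n_gt0) andbF.
Qed.

Lemma v_high k : (0 < k)%N -> (k.*2 < n)%N ->
  vv (n - k) = al * (T k.+1 - rh (T k.+1)) / 2.
Proof.
move=> k_gt0 lt_kn; rewrite /v /u.
have -> : ~~ odd n && (n - k == n./2)%N = false by lia.
have -> : (n - k <= n./2)%N = false by lia.
have -> : (n - (n - k) = k)%N by lia.
have -> : ~~ odd n && (k == n./2) = false by lia.
by have -> : (k <= n./2)%N by lia.
Qed.

Lemma v_middle : ~~ odd n -> vv n./2 = T n / T n.-1.
Proof. by move=> n_even; rewrite /v /u n_even eqxx. Qed.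

Lemma v_ind (P : M -> Prop) :
  (~~ odd n -> P (T n / T n.-1)) ->
  (forall k, (0 < k)%N -> (k.*2 < n)%N ->
     P ((T k.+1 + rh (T k.+1)) / 2) /\ P (al * (T k.+1 - rh (T k.+1)) / 2)) ->
  {in vs, forall g, P g}.
Proof.
move=> Pw Pv g /mapP[k]; rewrite mem_iota add1n prednK // => /andP[k_gt0 lt_kn] ->.
have [lt_2k|lt_2k|e2k] := ltngtP k.*2 n.
- by rewrite v_low //; case: (Pv k).
- have -> : k = (n - (n - k))%N by lia.
  by rewrite v_high; [case: (Pv (n - k)%N) => //; lia | lia | lia].
- have -> : k = n./2 by lia.
  by rewrite v_middle; [apply: Pw; lia | lia].
Qed.

Lemma v_mem k : (0 < k < n)%N -> vv k \in vs.
Proof. by move=> lt_k; apply: map_f; rewrite mem_iota; lia. Qed.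

(** Over L one may divide by alpha, so each pair v_i, v_(n-i) yields t_(i+1) and its image under
    [rho]; [mesym_adjoin] then gives all t_k. *)
Lemma adjoin_t (k : nat) : (k <= n)%N -> adjoin (@rfC L n) vs (T k).
Proof.
have [phi [rhoE phiC phiX]] := rho_rmorph.
apply: (@mesym_adjoin M n phi (@zvar K L alpha n) (@yvar K L alpha n) (z0 alpha n)
  (T n / T n.-1)) => //.
- exact: z0_neq0.
- exact: zvar_neq0.
- by move=> i le_in; apply: t_neq0.
- exact: rho_zvar.
- move=> n_even; rewrite -(v_middle n_even); apply: adjoin_gen.
  by apply: v_mem; lia.
move=> [|i] // le_iN; rewrite -rhoE.
(* The index in [mesym_adjoin] is i + 1, because v_i is built from t_(i+1). *)
have [i_gt0 lt_in] : (0 < i)%N /\ (i.*2 < n)%N by split; lia.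
have [lt_i lt_ni] : (0 < i < n)%N /\ (0 < n - i < n)%N by split; lia.
have := adjoin_gen (@rfC L n) (v_mem lt_i); rewrite v_low //.
have := adjoin_gen (@rfC L n) (v_mem lt_ni); rewrite v_high //.
set A := T i.+1; set B := rh A => GB GA.
have two0 := two_neq0 (@baseC K L n).
have GalB : adjoin (@rfC L n) vs (al * (A - B) / 2 / al).
  by apply: adjoin_div => //; apply: adjoin_const.
have [eA eB] := half_sum_difference A B two0 al_neq0.
split; first by have := adjoinD GA GalB; rewrite -eA.
by have := adjoin_sub GA GalB; rewrite -eB.
Qed.

Lemma norm_Z : Z * rh Z = f_of_t alpha n.
Proof.
have [phi [rhoE phiC phiX]] := rho_rmorph.
rewrite rhoE; apply: (@norm_difference_product M n phi (@zvar K L alpha n)) => //.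
- exact: z0_neq0.
- exact: zvar_neq0.
- by move=> i le_in; apply: t_neq0.
- exact: rho_zvar.
Qed.

(** [rho] exchanges t_(k+1) and its conjugate: the half sum is unchanged, while in alpha times the
    difference both factors change sign. The middle generator is covered by [rho_w]. *)
Lemma rho_fixed_v : {in vs, forall g, rh g = g}.
Proof.
have [phi [rhoE phiC phiX]] := rho_rmorph.
have phiK q : phi (phi q) = q by rewrite -!rhoE rho_involutive.
apply: v_ind => [_|k _ _].
  rewrite rhoE; apply: (@rho_w M n phi (@zvar K L alpha n) (@yvar K L alpha n)
    (z0 alpha n)) => //.
  - exact: z0_neq0.
  - exact: zvar_neq0.
  - by move=> i le_in; apply: t_neq0.
  - exact: rho_zvar.
have phi_al : phi al = - al by rewrite phiC conj_alpha rmorphN.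
have phi2 : phi 2 = 2 by rewrite rmorph_nat.
rewrite !rhoE !fmorph_div phi2; split; congr (_ / _).
  by rewrite rmorphD phiK addrC.
by rewrite rmorphM rmorphB phiK phi_al mulNr -mulrN opprB.
Qed.

Lemma twisted_act_fixed_v (s : 'S_n) : {in vs, forall g, twisted_act a%:A s g = g}.
Proof.
have tau_t := twisted_act_t s; have tau_rho q := twisted_act_rho s q.
have [tau [tauE tauC tauX]] := twisted_act_rmorph (n := n) s aA_neq0.
have tau2 : tau 2 = 2 by rewrite rmorph_nat.
have {}tau_t k : tau (T k) = T k by rewrite -tauE tau_t.
have {}tau_rho k : tau (rh (T k)) = rh (T k) by rewrite -tauE tau_rho tauE tau_t.
apply: v_ind => [_|k _ _]; first by rewrite tauE fmorph_div !tau_t.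
rewrite !tauE !fmorph_div tau2; split; congr (_ / _).
  by rewrite rmorphD tau_t tau_rho.
by rewrite rmorphM rmorphB tauC tau_t tau_rho.
Qed.

(** As an expression in the t_k, f lies in L(v_1, ..., v_(n-1)); being the norm Z rho(Z), it is
    fixed by [rho] and descends to K. This gives h its coefficients in K. *)
Lemma adjoin_f : adjoin (@baseC K L n) vs (f_of_t alpha n).
Proof.
apply: (rho_descent rho_fixed_v); last first.
  rewrite -norm_Z; have rhoK := rho_involutive.
  have [phi [rhoE phiC phiX]] := rho_rmorph.
  by rewrite [rh (Z * _)]rhoE rmorphM -!rhoE rhoK mulrC.
have GD : adjoin (@rfC L n) vs (difference_product (@yvar K L alpha n) ^+ 2).
  by apply: difference_product_sqr_adjoin => k /andP[_ /adjoin_t].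
have Gn := adjoin_t (leqnn n); have Gn1 := adjoin_t (leq_pred n).
apply: adjoinM => //; apply: adjoinM; last by apply/adjoinX/adjoin_div.
apply: adjoinM; last by apply/adjoinV/adjoinX.
by apply/adjoinX/adjoinN/adjoin1.
Qed.

(** * The generators x and y, as components of Z along 1 and alpha *)

Let X : M := (Z + rh Z) / 2.
Let Y : M := (Z - rh Z) / (2 * al).

Lemma norm_XY : X ^+ 2 - baseC L n a * Y ^+ 2 = f_of_t alpha n.
Proof.
rewrite -norm_Z -al_sqr.
exact: quadratic_norm (two_neq0 (@baseC K L n)) al_neq0.
Qed.

Lemma Z_XY : Z = X + al * Y.
Proof. exact: quadratic_recover (two_neq0 (@baseC K L n)) al_neq0. Qed.

Lemma rho_fixed_generators : {in [:: X, Y & vs], forall g, rh g = g}.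
Proof.
have [phi [rhoE phiC phiX]] := rho_rmorph.
have phiK q : phi (phi q) = q by rewrite -!rhoE rho_involutive.
move=> g; rewrite !inE => /or3P[/eqP->|/eqP->|]; last exact: rho_fixed_v.
  by rewrite /X !rhoE fmorph_div rmorphD phiK rmorph_nat addrC.
have phi_al : phi al = - al by rewrite phiC conj_alpha rmorphN.
rewrite /Y !rhoE fmorph_div rmorphB phiK (rmorphM phi 2 al) phi_al rmorph_nat.
by rewrite mulrN invrN mulrN -mulNr opprB.
Qed.

Lemma twisted_act_fixed_generators (s : 'S_n) :
  {in [:: X, Y & vs], forall g, twisted_act a%:A s g = g}.
Proof.
move=> g; rewrite !inE => /or3P[/eqP->|/eqP->|]; last exact: twisted_act_fixed_v.
all: have tau_Z := twisted_act_Z s; have tau_rho := twisted_act_rho s Z.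
all: have [tau [tauE tauC tauX]] := twisted_act_rmorph (n := n) s aA_neq0.
all: rewrite !tauE in tau_Z tau_rho *; rewrite fmorph_div.
  by rewrite rmorphD tau_rho tau_Z rmorph_nat.
by rewrite rmorphB (rmorphM tau 2 al) tau_rho tau_Z rmorph_nat tauC.
Qed.

(** Invariants under the symmetric group lie in L(x, y, v_1, ..., v_(n-1)), which contains the t_k
    and Z = x + alpha y; invariance under [rho] then descends the coefficients to K. Conversely, all
    generators are fixed by both actions. *)
Lemma twisted_fixed_field (q : M) :
  (exists p : ratfun K n, twisted_fixed a p /\ q = incl L p) <->
  adjoin (@baseC K L n) [:: X, Y & vs] q.
Proof.
rewrite twisted_fixedP; split=> [[rho_q tau_q]|Gq]; last first.
  split=> [|s].
    have [phi [rhoE phiC phiX]] := rho_rmorph.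
    rewrite rhoE; apply: (adjoin_fixed _ _ Gq) => [c|g Gg].
      by rewrite phiC rhoL_alg.
    by rewrite -rhoE rho_fixed_generators.
  have tau_g := twisted_act_fixed_generators s.
  have [tau [tauE tauC tauX]] := twisted_act_rmorph (n := n) s aA_neq0.
  rewrite tauE; apply: (adjoin_fixed _ _ Gq) => [c|g Gg]; first exact: tauC.
  by rewrite -tauE tau_g.
apply: (rho_descent rho_fixed_generators) => //.
pose sigma s := sval (twisted_act_rmorph (n := n) s aA_neq0).
have sigmaP s : [/\ twisted_act a%:A s =1 sigma s, forall c, sigma s (rfC n c) = rfC n c
    & forall j, sigma s (rfX L j) = twisted_var a%:A s j].
  exact: svalP (twisted_act_rmorph (n := n) s aA_neq0).
apply: (@twisted_invariant_adjoin L M n (@rfC L n) (@zvar K L alpha n)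
  (@yvar K L alpha n) (z0 alpha n) sigma) => //.
- exact: zvar_indep.
- exact: zvar_generates.
- exact: z0_neq0.
- by move=> s c; case: (sigmaP s) => _ sC _; apply: sC.
- by move=> s j; case: (sigmaP s) => _ sC sX; apply: twisted_zvar.
- move=> k /andP[_ le_kn]; apply: (adjoin_sub_adjoin _ _ (adjoin_t le_kn)).
    exact: adjoin_const.
  move=> g vg; apply: adjoin_gen.
  by rewrite in_cons; apply/orP; right; rewrite in_cons; apply/orP; right.
- rewrite -[_ * _]/Z Z_XY; apply: adjoinD; first by apply: adjoin_gen; rewrite mem_head.
  apply: adjoinM; first exact: adjoin_const.
  by apply: adjoin_gen; rewrite !inE eqxx orbT.
- by move=> s; case: (sigmaP s) => <-.
Qed.

(** Membership of f in K(v_1, ..., v_(n-1)) provides a fraction whose denominator does not vanish at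
    the v_k. The variable of index j stands for v_(j+1). *)
Lemma f_rational : exists h : ratfun K n.-1,
  rf_value (@baseC K L n) (fun j : 'I_n.-1 => vv j.+1) h (f_of_t alpha n).
Proof.
have vsP : {in vs, forall g, exists j : 'I_n.-1, g = vv j.+1}.
  move=> g /mapP[k]; rewrite mem_iota add1n => /andP[k_gt0 lt_kn] ->.
  have lt_k1 : (k.-1 < n.-1)%N by lia.
  by exists (Ordinal lt_k1); rewrite /= prednK.
have [num [den [den0 fE]]] := adjoin_ratio vsP adjoin_f.
by exists (num%:F / den%:F), num, den.
Qed.

End Concrete.

Theorem theorem3p4 (K : fieldType) (char_neq2 : 2%N \notin [pchar K])
    (a : K) (a_neq0 : a != 0) (a_nonsquare : forall b : K, b ^+ 2 != a)
    (L : fieldExtType K) (alpha : L) (alpha_sqr : alpha ^+ 2 = a%:A)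
    (L_gen : <<1; alpha>>%VS = fullv)
    (rhoL : {lrmorphism L -> L}) (conj_alpha : rhoL alpha = - alpha)
    (n : nat) (n_ge2 : (2 <= n)%N) :
  exists h : ratfun K n.-1,
    rf_value (@baseC K L n) (fun j : 'I_n.-1 => v alpha rhoL n j.+1) h
      (f_of_t alpha n)
    /\ exists x y : ratfun L n,
      (forall z : ratfun L n,
         (exists q : ratfun K n, twisted_fixed a q /\ z = incl L q)
         <-> adjoin (@baseC K L n)
               [:: x, y & [seq v alpha rhoL n k | k <- iota 1 n.-1]] z)
      /\ rf_value (@baseC K L n) (fun j : 'I_n.-1 => v alpha rhoL n j.+1) h
           (x ^+ 2 - baseC L n a * y ^+ 2).
Proof.
have [h hf] := f_rational char_neq2 a_neq0 alpha_sqr L_gen conj_alpha n_ge2.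
exists h; split=> //.
pose Z : ratfun L n := z0 alpha n * difference_product (@yvar K L alpha n).
exists ((Z + rho rhoL Z) / 2), ((Z - rho rhoL Z) / (2 * rfC n alpha)).
split; first exact: twisted_fixed_field.
(* The norm x^2 - a y^2 is [f_of_t], whose expression through h is [hf]. *)
by rewrite (norm_XY char_neq2 a_neq0 alpha_sqr conj_alpha).
Qed.
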